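(* Let $M$ be a finitely generated faithful multiplication $R$-module and let $S$ be a multiplicatively closed subset of $R$. For a submodule $N$ of $M$ with $(N:_{R}M)\cap S=\emptyset$, the following statements are equivalent. (1) $N$ is an $S$-$1$-absorbing primary submodule of $M$. (2) $N=IM$ for some $S$-$1$-absorbing primary ideal $I$ of $R$. (3) $(N:_{R}M)$ is an $S$-$1$-absorbing primary ideal of $R$.
   Context: All rings are commutative with non-zero identity and all modules are unital. An $R$-module $M$ is a multiplication module if every submodule of $M$ has the form $IM$ for some ideal $I$ of $R$. For a submodule $N$ of $M$, $(N:_{R}M)=\{r\in R\mid rM\subseteq N\}$. A prime submodule of $M$ is a proper submodule $P$ such that $rm\in P$ ($r\in R$, $m\in M$) implies $r\in(P:_RM)$ or $m\in P$. $M\text{-}rad(N)$ is the intersection of all prime submodules of $M$ containing $N$ (it equals $M$ if there are none). A submodule $N$ of $M$ with $(N:_{R}M)\cap S=\emptyset$ is called $S$-$1$-absorbing primary if there exists a fixed $s\in S$ such that for all non-unit $a,b\in R$ and all $m\in M$, if $abm\in N$, then $sab\in(N:_{R}M)$ or $sm\in M\text{-}rad(N)$. A proper ideal $I$ of $R$ with $I\cap S=\emptyset$ is called $S$-$1$-absorbing primary if there exists a fixed $s\in S$ such that for all non-unit $a,b,c\in R$, if $abc\in I$, then $sab\in I$ or $sc\in\sqrt{I}$. *)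

(* Defs.v *)
From mathcomp Require Import all_boot all_algebra.
From mathcomp Require Import boolp classical_sets.
Set Implicit Arguments.
Unset Strict Implicit.
Unset Printing Implicit Defensive.
Import GRing.Theory.
Local Open Scope ring_scope.
Local Open Scope classical_set_scope.

(* A commutative ring with 1 <> 0 is a [comUnitRingType]: the
   extra structure over [comNzRingType] only names the invertible elements, so
   that "unit" is [GRing.unit]; classically every such ring carries it. *)

Definition is_submodule (R : comUnitRingType) (M : lmodType R) (N : set M) : Prop :=
  submod_closed (mem N).

(* R^o is R as a module over itself.  Unlike [idealr_closed], this allows the
   unit ideal, which multiplication modules need (M = RM). *)
Definition is_ideal (R : comUnitRingType) (I : set R) : Prop :=
  @is_submodule R R^o I.

(* IM is generated by the products a *: m, i.e. consists of their finite sums. *)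
Definition ideal_mul (R : comUnitRingType) (M : lmodType R) (I : set R) : set M :=
  [set x | exists n (a : 'I_n -> R) (m : 'I_n -> M),
     (forall i, I (a i)) /\ x = \sum_(i < n) a i *: m i].
Arguments ideal_mul {R} M I.

Definition colon (R : comUnitRingType) (M : lmodType R) (N : set M) : set R :=
  [set r | forall m : M, N (r *: m)].

Definition finitely_generated (R : comUnitRingType) (M : lmodType R) : Prop :=
  exists n (g : 'I_n -> M), forall x : M,
    exists c : 'I_n -> R, x = \sum_(i < n) c i *: g i.

Definition faithful_module (R : comUnitRingType) (M : lmodType R) : Prop :=
  forall r : R, (forall m : M, r *: m = 0) -> r = 0.

Definition multiplication_module (R : comUnitRingType) (M : lmodType R) : Prop :=
  forall N : set M, is_submodule N ->
    exists I : set R, is_ideal I /\ N = ideal_mul M I.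

Definition prime_submodule (R : comUnitRingType) (M : lmodType R) (P : set M) : Prop :=
  [/\ is_submodule P, P <> setT &
      forall (r : R) (m : M), P (r *: m) -> colon P r \/ P m].

(* The empty intersection is [setT]. *)
Definition Mrad (R : comUnitRingType) (M : lmodType R) (N : set M) : set M :=
  \bigcap_(P in [set P | prime_submodule P /\ N `<=` P]) P.

Definition ideal_radical (R : comUnitRingType) (I : set R) : set R :=
  [set r | exists2 n, (0 < n)%N & I (r ^+ n)].

Definition S_1_absorbing_primary_submodule (R : comUnitRingType) (M : lmodType R)
    (S : set R) (N : set M) : Prop :=
  [/\ is_submodule N, colon N `&` S = set0 &
      exists2 s : R, S s &
        forall (a b : R) (m : M),
          a \isn't a GRing.unit -> b \isn't a GRing.unit ->
          N ((a * b) *: m) -> colon N (s * a * b) \/ Mrad N (s *: m)].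

Definition S_1_absorbing_primary_ideal (R : comUnitRingType)
    (S : set R) (I : set R) : Prop :=
  [/\ is_ideal I, I <> setT, I `&` S = set0 &
      exists2 s : R, S s &
        forall a b c : R,
          a \isn't a GRing.unit -> b \isn't a GRing.unit ->
          c \isn't a GRing.unit ->
          I (a * b * c) -> I (s * a * b) \/ ideal_radical I (s * c)].

(* Main.v *)
Require Import Defs.
From mathcomp Require Import all_boot all_algebra.
From mathcomp Require Import boolp classical_sets.
Local Open Scope ring_scope.
Local Open Scope classical_set_scope.
Import GRing.Theory.

(** The module hypotheses enter through one fact: IM determines I.  Two classical
tools give it.  Krull's lemma, by Zorn, puts a prime p over any ideal I in such a
way that p avoids an r with no power in I ([prime_avoiding]).  Nakayama's lemma at
such a prime gives pM <> M ([prime_mul_neqT]), because M is finitely generated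
and faithful.

Because M is a multiplication module, a cyclic submodule Rx is JM for an ideal J,
and if x lies outside pM, then J is not inside p.  So some t outside p satisfies
tM <= Rx, which means that M is cyclic locally at p.  For rM <= IM this yields
t^2 r in I; as such a t exists for each prime p, the ideal of the k with kr in I
lies in no prime and contains 1.  Hence (IM : M) = I ([colon_ideal_mul]).  As
also N = (N : M)M, the only ideal I with N = IM is (N : M), so the two conditions on
ideals say the same.

The same cancellation makes pM a prime submodule with (pM : M) = p.  The
submodules pM for p over (N : M) thus bound M-rad(N) from above well enough to show
that r M <= M-rad(N) forces r into the radical of (N : M) ([colon_Mrad_sub]).
If abc lies in (N : M), the condition on N applies to a, b and every cm, and so
gives the condition on (N : M).  Conversely, given m with abm in N, write Rm = JM.
Then abJ <= (N : M), and the condition on (N : M) applies to a, b and every j in J;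
a unit in J is harmless because it puts ab itself in (N : M). *)

(** * Submodules and ideals *)

Lemma submoduleP {R : comUnitRingType} {M : lmodType R} (N : set M) :
  is_submodule N <->
  N 0 /\ (forall (a : R) (x y : M), N x -> N y -> N (a *: x + y)).
Proof.
split=> [[N0 NL]|[N0 NL]].
  split=> [|a x y Nx Ny]; first by move: N0; rewrite in_setE.
  by have := NL a x y; rewrite !in_setE; apply.
by split=> [|a x y]; rewrite !in_setE //; apply: NL.
Qed.

Section Submodule.
Context {R : comUnitRingType} {M : lmodType R} {N : set M}.
Hypothesis subN : is_submodule N.

Lemma submodule0 : N 0. Proof. by case/submoduleP: subN. Qed.

Lemma submoduleZ (a : R) x : N x -> N (a *: x).
Proof.
by case/submoduleP: subN => N0 NL Nx; rewrite -[_ *: _]addr0; apply: NL.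
Qed.

Lemma submoduleD x y : N x -> N y -> N (x + y).
Proof.
by case/submoduleP: subN => N0 NL Nx Ny; rewrite -[x]scale1r; apply: NL.
Qed.

Lemma submodule_sum (n : nat) (F : 'I_n -> M) :
  (forall i, N (F i)) -> N (\sum_(i < n) F i).
Proof.
move=> NF; elim/big_ind: _ => //; [exact: submodule0 | exact: submoduleD].
Qed.

End Submodule.

Section Ideal.
Context {R : comUnitRingType} {I : set R}.
Hypothesis idI : is_ideal I.

Lemma idealMl a x : I x -> I (a * x).
Proof. exact: (submoduleZ (M := R^o) idI a x). Qed.

Lemma idealMr a x : I x -> I (x * a).
Proof. by rewrite mulrC; apply: idealMl. Qed.

Lemma idealD x y : I x -> I y -> I (x + y).
Proof. exact: (submoduleD (M := R^o) idI x y). Qed.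

Lemma idealBr x y : I (x - y) -> I y -> I x.
Proof. by move=> Ixy Iy; rewrite -(subrK y x); apply: idealD. Qed.

End Ideal.

Lemma idealP {R : comUnitRingType} (I : set R) :
  is_ideal I <-> I 0 /\ (forall a x y : R, I x -> I y -> I (a * x + y)).
Proof. exact: (@submoduleP R R^o I). Qed.

Lemma colon_ideal {R : comUnitRingType} {M : lmodType R} (N : set M) :
  is_submodule N -> is_ideal (colon N).
Proof.
move=> subN; apply/idealP; split=> [m|a x y Nx Ny m].
  by rewrite scale0r; apply: submodule0.
by rewrite scalerDl -scalerA; apply: submoduleD => //; apply: submoduleZ.
Qed.

Section IdealMul.
Context {R : comUnitRingType} {M : lmodType R}.
Implicit Types (I : set R) (N : set M).

Lemma ideal_mul_scale I a (m : M) : I a -> ideal_mul M I (a *: m).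
Proof.
by move=> Ia; exists 1%N, (fun=> a), (fun=> m); split=> //; rewrite big_ord1.
Qed.

Lemma ideal_mul_min I N : is_submodule N -> I `<=` colon N -> ideal_mul M I `<=` N.
Proof.
by move=> subN IN _ [n [a [m [Ia ->]]]]; apply: submodule_sum => // i; apply: IN.
Qed.

Lemma ideal_mul_submodule I : is_ideal I -> is_submodule (ideal_mul M I).
Proof.
move=> idI; apply/submoduleP; split.
  by rewrite -(scale0r (0 : M)); apply: ideal_mul_scale; case/idealP: idI.
move=> c _ _ [n [a [x [Ia ->]]]] [k [b [y [Ib ->]]]].
exists (n + k)%N, (fun i => match split i with inl j => c * a j | inr j => b j end),
  (fun i => match split i with inl j => x j | inr j => y j end); split.
  by move=> i; case: (split i) => j //; apply: idealMl.
rewrite big_split_ord scaler_sumr /=; congr (_ + _); apply: eq_bigr => i _.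
  by rewrite (unsplitK (inl i)) scalerA.
by rewrite (unsplitK (inr i)).
Qed.

Lemma ideal_mulS I I' : I `<=` I' -> ideal_mul M I `<=` ideal_mul M I'.
Proof.
by move=> II' _ [n [a [m [Ia ->]]]]; exists n, a, m; split=> // i; apply: II'.
Qed.

End IdealMul.

(** * Primes and Krull's lemma *)

Definition prime_ideal {R : comUnitRingType} (p : set R) : Prop :=
  [/\ is_ideal p, ~ p 1 & forall a b, p (a * b) -> p a \/ p b].

(** An ideal maximal among those that contain I and avoid the powers of r is
prime: for a, b outside it, the ideals it spans with a and with b contain powers
of r, whose product would be a power of r in it if ab were. *)
Lemma prime_avoiding {R : comUnitRingType} (I : set R) (r : R) :
  is_ideal I -> (forall n, ~ I (r ^+ n)) ->
  exists p, [/\ prime_ideal p, I `<=` p & ~ p r].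
Proof.
move=> idI Ir.
(* Zorn's lemma below also takes the union of the empty chain, so the candidates
   are the sets that become suitable ideals after a union with I. *)
pose P := [set J : set R | is_ideal (I `|` J) /\ forall n, ~ (I `|` J) (r ^+ n)].
have [|A [[idA Ar] maxA]] := @Zorn_bigcup _ P.
  move=> F FP totF; split; last first.
    by move=> n [/Ir//|[J FJ Jr]]; case: (FP J FJ) => _ /(_ n); apply; right.
  apply/idealP; split; first by left; case/idealP: idI.
  move=> a x y Ux Uy.
  have [[Ix Iy]|[J FJ [Jx Jy]]] : (I x /\ I y) \/
      exists2 J, F J & (I `|` J) x /\ (I `|` J) y.
  - case: Ux Uy => [Ix|[J FJ Jx]] [Iy|[K FK Ky]].
    + by left.
    + by right; exists K => //; split; [left | right].
    + by right; exists J => //; split; [right | left].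
    + case: (totF J K FJ FK) => [JK|KJ].
        by right; exists K => //; split; right => //; apply: JK.
      by right; exists J => //; split; right => //; apply: KJ.
  - by left; apply: idealD => //; apply: idealMl.
  - case: (FP J FJ) => /idealP[_ /(_ a x y Jx Jy) [IJ|JJ] _]; first by left.
    by right; exists J.
pose p := I `|` A; have Ip : I `<=` p by left.
have span_power a : ~ p a -> exists n z c, p z /\ r ^+ n = z + c * a.
  move=> pa; apply: contrapT => npow.
  pose B := [set y | exists z c, p z /\ y = z + c * a].
  have pB : p `<=` B by move=> z pz; exists z, 0; rewrite mul0r addr0.
  have UB : I `|` B = B by apply/seteqP; split=> [x [/Ip/pB|]|x Bx] //; right.
  apply: (maxA B).
    split=> [x Ax|BA]; first by apply: pB; right.
    apply: pa; right; apply: BA; exists 0, 1; rewrite mul1r add0r.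
    by split=> //; case/idealP: idA.
  split; rewrite UB; last by move=> n [z [c zc]]; apply: npow; exists n, z, c.
  apply/idealP; split; first by apply: pB; case/idealP: idA.
  move=> b _ _ [z [c [pz ->]]] [z' [c' [pz' ->]]].
  exists (b * z + z'), (b * c + c'); split; first by case/idealP: idA => _; apply.
  by rewrite mulrDr mulrDl !mulrA addrACA.
exists p; split=> //; last by have := Ar 1%N; rewrite expr1.
split=> //; first by have := Ar 0%N; rewrite expr0.
move=> a b pab; apply: contrapT => /not_orP[/span_power[n [z [c [pz rn]]]]].
move=> /span_power[k [z' [c' [pz' rk]]]].
apply: (Ar (n + k)%N); rewrite exprD rn rk mulrDl [c * a * _]mulrDr mulrACA.
apply: idealD => //; first exact: idealMr.
by apply: idealD => //; apply: idealMl.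
Qed.

(** Nakayama's lemma at p.  If pM = M, generators can be dropped one at a time at
the price of a factor outside p: from t M <= Rg_0 + ... + Rg_k and g_k in pM one
gets t g_k = d_0 g_0 + ... + d_k g_k with all d_i in p, so t - d_k is outside p
and multiplies g_k into the span of the earlier generators.  With no generator
left, some t outside p kills M, which contradicts faithfulness. *)
Lemma prime_mul_neqT {R : comUnitRingType} {M : lmodType R} (p : set R) :
  finitely_generated M -> faithful_module M ->
  prime_ideal p -> ideal_mul M p <> setT.
Proof.
move=> [n [g genM]] faithM [idp p1 pM] pT; have p0 : p 0 by case/idealP: idp.
suff drop k : (k <= n)%N -> exists2 t, ~ p t & forall x, exists2 c : 'I_n -> R,
    (forall i : 'I_n, (n - k <= i)%N -> c i = 0) & t *: x = \sum_(i < n) c i *: g i.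
  have [t pt] := drop n (leqnn n); rewrite subnn => tM.
  apply: pt; rewrite (faithM t) // => x; have [c c0 ->] := tM x.
  by apply: big1 => i _; rewrite c0 // scale0r.
elim: k => [|k IHk] le_kn.
  exists 1 => // x; have [c ->] := genM x; exists c; last by rewrite scale1r.
  by move=> i; rewrite subn0 leqNgt ltn_ord.
have [t pt tM] := IHk (ltnW le_kn).
have lt_ln : (n - k.+1 < n)%N by rewrite ltn_subrL (leq_ltn_trans _ le_kn).
pose l := Ordinal lt_ln.
have eq_l : (n - k)%N = l.+1 by rewrite /= subnSK.
have [d [pd d0 tgl]] : exists d : 'I_n -> R, [/\ forall i, p (d i),
    forall i : 'I_n, (n - k <= i)%N -> d i = 0 & t *: g l = \sum_(i < n) d i *: g i].
  have [m [a [x [pa gl]]]] : ideal_mul M p (g l) by rewrite pT.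
  have [c cP] := choice (fun j => let: ex_intro2 c c0 ctx := tM (x j) in
    ex_intro (fun c => _ /\ _) c (conj c0 ctx)).
  exists (fun i => \sum_(j < m) a j * c j i); split=> [i|i le_i|].
  - by apply: (submodule_sum (M := R^o) idp) => j; apply: idealMr.
  - by apply: big1 => j _; rewrite (cP j).1 // mulr0.
  - rewrite gl scaler_sumr; under [RHS]eq_bigr do rewrite scaler_suml.
    rewrite exchange_big; apply: eq_bigr => j _ /=.
    rewrite scalerA mulrC -scalerA (cP j).2 scaler_sumr.
    by apply: eq_bigr => i _; rewrite scalerA.
have ugl : (t - d l) *: g l = \sum_(i < n | i != l) d i *: g i.
  by rewrite scalerBl tgl (bigD1 l) //= addrAC subrr add0r.
exists ((t - d l) * t).
  by case/pM => // /(idealBr idp)/(_ (pd l)).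
move=> x; have [c c0 tx] := tM x.
exists (fun i => if i == l then 0 else (t - d l) * c i + c l * d i).
  move=> i le_li; case: eqP => [//|/eqP neq_il].
  have lt_li : (n - k <= i)%N by rewrite eq_l ltn_neqAle eq_sym neq_il.
  by rewrite (c0 i) // (d0 i) // !mulr0 addr0.
rewrite -scalerA tx (bigD1 l) //= scalerDr scalerA mulrC -scalerA ugl.
rewrite [RHS](bigD1 l) //= eqxx scale0r add0r !scaler_sumr -big_split /=.
apply: eq_bigr => i /negPf ->.
by rewrite scalerDl !scalerA addrC.
Qed.

(** * Multiplication modules *)

Section MultiplicationModule.
Context {R : comUnitRingType} {M : lmodType R}.
Hypothesis multM : multiplication_module M.

Lemma ideal_mul_colon (N : set M) : is_submodule N -> ideal_mul M (colon N) = N.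
Proof.
move=> subN; apply/seteqP; split; first exact: ideal_mul_min.
have [I [idI ->]] := multM N subN.
by apply: ideal_mulS => a Ia m; apply: ideal_mul_scale.
Qed.

(** The ideal J = (Rx : M) of a cyclic submodule satisfies Rx = JM. *)
Lemma cyclic_ideal (x : M) : exists2 J : set R,
  ideal_mul M J x & forall j y, J j -> exists c, j *: y = c *: x.
Proof.
pose N : set M := [set y | exists c, y = c *: x].
have subN : is_submodule N.
  apply/submoduleP; split; first by exists 0; rewrite scale0r.
  by move=> a _ _ [c ->] [d ->]; exists (a * c + d); rewrite scalerDl scalerA.
exists (colon N); last by move=> j y /(_ y).
by rewrite ideal_mul_colon //; exists 1; rewrite scale1r.
Qed.

Hypotheses (fgM : finitely_generated M) (faithM : faithful_module M).

(** M is cyclic locally at p: the generator is any x outside pM, and t is an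
element outside p of the ideal J with Rx = JM. *)
Lemma locally_cyclic (p : set R) : prime_ideal p ->
  exists t x, ~ p t /\ forall y : M, exists c, t *: y = c *: x.
Proof.
move=> prp.
have [x pMx] : exists x, ~ ideal_mul M p x.
  apply: contrapT => /forallNP allp; apply: (prime_mul_neqT _ fgM faithM prp).
  by apply/seteqP; split=> // x _; apply: contrapT; apply: allp.
have [J JMx Jx] := cyclic_ideal x.
apply: contrapT => noT; apply/pMx/(ideal_mulS J p _ _ JMx) => t Jt.
apply: contrapT => pt; apply: noT; exists t, x; split=> // y; exact: Jx.
Qed.

(** Cancellation.  When tM <= Rx, every y in IM has t y in Ix.  Applied to y = rx
this gives (tr - i)x = 0 with i in I, hence t(tr - i) kills M, and t^2 r = ti lies
in I by faithfulness. *)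
Lemma colon_ideal_mul (I : set R) : is_ideal I -> colon (ideal_mul M I) = I.
Proof.
move=> idI; apply/seteqP; split=> [r rM|a Ia m]; last exact: ideal_mul_scale.
pose K : set R := [set k | I (k * r)].
have idK : is_ideal K.
  apply/idealP; split; first by rewrite /K /= mul0r; case/idealP: idI.
  move=> a x y Kx Ky; rewrite /K /= mulrDl -mulrA.
  by apply: idealD => //; apply: idealMl.
apply: contrapT => Ir.
have [|p [prp Kp _]] := prime_avoiding _ 1 idK.
  by move=> n; rewrite expr1n /K /= mul1r.
have [t [x [pt tMx]]] := locally_cyclic _ prp.
have tIM y : ideal_mul M I y -> exists2 i, I i & t *: y = i *: x.
  move=> [n [a [m [Ia ->]]]]; have [c tm] := choice (fun i => tMx (m i)).
  exists (\sum_(i < n) a i * c i).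
    by apply: (submodule_sum (M := R^o) idI) => i; apply: idealMr.
  rewrite scaler_sumr scaler_suml; apply: eq_bigr => i _.
  by rewrite scalerA [t * _]mulrC -!scalerA tm.
have [i Ii trx] := tIM _ (rM x).
have tri0 : t * (t * r - i) = 0.
  apply: faithM => y; have [c ty] := tMx y.
  rewrite mulrC -scalerA ty scalerA mulrC -scalerA scalerBl -scalerA trx.
  by rewrite subrr scaler0.
apply: pt; case: prp => _ _ pM; suff /pM[] : p (t * t) by [].
apply: Kp; rewrite /K /= -mulrA.
by move/eqP: tri0; rewrite mulrBr subr_eq0 => /eqP ->; apply: idealMl.
Qed.

(** If rm lies in pM and Rm = JM, then rJ <= (pM : M) = p, so r or all of J is
in p. *)
Lemma prime_ideal_mul (p : set R) :
  prime_ideal p -> prime_submodule (ideal_mul M p).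
Proof.
move=> prp; have [idp p1 pM] := prp; have subpM := ideal_mul_submodule _ idp.
split=> // [|r m pMrm]; first exact: prime_mul_neqT.
rewrite colon_ideal_mul //; have [|pr] := pselect (p r); [by left | right].
have [J JMm Jm] := cyclic_ideal m.
apply: (ideal_mulS J p _ _ JMm) => j Jj.
suff /pM[] : p (r * j) by [].
rewrite -(colon_ideal_mul p) // => y; have [c jy] := Jm j y Jj.
by rewrite -scalerA jy scalerA [_ * c]mulrC -scalerA; apply: submoduleZ.
Qed.

(** A prime p over (N : M) gives the prime submodule pM over N, and
(pM : M) = p; so r M <= M-rad(N) puts r in every such p. *)
Lemma colon_Mrad_sub (N : set M) : is_submodule N ->
  colon (Mrad N) `<=` ideal_radical (colon N).
Proof.
move=> subN r radr; apply: contrapT => Nr.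
have idN := colon_ideal _ subN.
have [n Nrn|p [prp Np pr]] := prime_avoiding _ r idN.
  by apply: Nr; exists n.+1; rewrite // exprS; apply: (idealMl idN).
have [idp _ _] := prp; apply: pr; rewrite -(colon_ideal_mul p) // => m.
apply: (radr m); split; first exact: prime_ideal_mul.
by rewrite -{1}(ideal_mul_colon N) //; apply: ideal_mulS.
Qed.

End MultiplicationModule.

(** * Prime submodules and the radical of a submodule *)

Section Radical.
Context {R : comUnitRingType} {M : lmodType R}.
Implicit Types (N P : set M).

Lemma prime_colonX P r n : prime_submodule P -> colon P (r ^+ n) -> colon P r.
Proof.
move=> [subP PT prP]; elim: n => [|n IHn] Prn.
  by move=> m; apply: submoduleZ => //; rewrite -[m]scale1r; apply: Prn.
have [//|Pr] := pselect (colon P r); apply: IHn => m.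
by have := Prn m; rewrite exprS -scalerA => /prP[].
Qed.

Lemma Mrad_submodule N : is_submodule (Mrad N).
Proof.
apply/submoduleP; split=> [P [[subP _ _] _]|a x y radx rady P NP].
  exact: submodule0.
have [[subP _ _] _] := NP.
by apply: submoduleD => //; [apply: submoduleZ => //; apply: radx | apply: rady].
Qed.

Lemma radical_sub_colon_Mrad N : ideal_radical (colon N) `<=` colon (Mrad N).
Proof.
move=> r [n _ Nrn] m P [prP NP].
by apply: (prime_colonX P r n) => // x; apply: NP.
Qed.

End Radical.

(** * The equivalence *)

Section Equivalence.
Context {R : comUnitRingType} {M : lmodType R}.
Hypothesis multM : multiplication_module M.
Variables (S : set R) (N : set M).
Hypothesis subN : is_submodule N.

Lemma submodule_colon_S_1_absorbing :
  finitely_generated M -> faithful_module M ->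
  S_1_absorbing_primary_submodule S N -> S_1_absorbing_primary_ideal S (colon N).
Proof.
move=> fgM faithM [_ NS [s Ss absN]]; have idN := colon_ideal _ subN.
split=> //; first by move=> NT; have : set0 s by rewrite -NS NT.
exists s => // a b c ua ub _ Nabc.
have [|Nsab] := pselect (colon N (s * a * b)); [by left | right].
apply: (colon_Mrad_sub multM fgM faithM _ subN) => m; rewrite -scalerA.
by case: (absN a b (c *: m)) => //; rewrite scalerA; apply: Nabc.
Qed.

(** With Rm = JM, the submodule abJM is generated by abm, so abm in N gives
abJ <= (N : M).  If sab is not in (N : M), each j in J has sj in the radical of
(N : M), and m itself is in JM. *)
Lemma colon_submodule_S_1_absorbing :
  S_1_absorbing_primary_ideal S (colon N) -> S_1_absorbing_primary_submodule S N.
Proof.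
move=> [idN _ NS [s Ss absN]]; split=> //; exists s => // a b m ua ub Nabm.
have [|Nsab] := pselect (colon N (s * a * b)); [by left | right].
have [J [n [j [x [Jj mE]]]] Jm] := cyclic_ideal multM m.
rewrite mE scaler_sumr; apply: submodule_sum => [|i]; first exact: Mrad_submodule.
have Nabj : colon N (a * b * j i).
  move=> y; have [c jy] := Jm (j i) y (Jj i).
  by rewrite -scalerA jy scalerA [_ * c]mulrC -scalerA; apply: submoduleZ.
rewrite scalerA; apply: radical_sub_colon_Mrad.
have [uj|uj] := boolP (j i \is a GRing.unit); last by case: (absN a b (j i)).
case: Nsab; rewrite -mulrA; apply: (idealMl idN).
by rewrite -(mulrK uj (a * b)); apply: (idealMr idN).
Qed.

End Equivalence.

Theorem theorem4 (R : comUnitRingType) (M : lmodType R)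
    (fgM : finitely_generated M) (faithM : faithful_module M)
    (multM : multiplication_module M)
    (S : set R) (mulS : mulr_closed (mem S))
    (N : set M) (subN : is_submodule N) (NS : colon N `&` S = set0) :
  [<-> S_1_absorbing_primary_submodule S N;
       exists I : set R, S_1_absorbing_primary_ideal S I /\ N = ideal_mul M I;
       S_1_absorbing_primary_ideal S (colon N)].
Proof.
tfae.
- move=> absN; exists (colon N); split; last by rewrite ideal_mul_colon.
  exact: submodule_colon_S_1_absorbing.
- by move=> [I [absI ->]]; have [idI _ _ _] := absI; rewrite colon_ideal_mul.
- exact: colon_submodule_S_1_absorbing.
Qed.
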